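(* Let $p$ be a prime, $n\ge1$, $s>0$ an integer, and let $U$ and $U_m$ ($m\ge1$) be additive subgroups of $\mathcal{A}_{n,p}=R^n$ with $U\subset U_m$ and such that $e(U)$ and $e(U_m)$ divide $s$ for all $m$. Suppose $U_m\to U$ (in the space of subsets of $R^n$). Then for any $v\in R^n$, the subgroups $V_m\le\mathcal{L}_{n,p}$ with triples $(s,U_m,v)$ converge to the subgroup $V$ with triple $(s,U,v)$.
   Context: $R=\mathbb{F}_p[x,x^{-1}]$; $\mathcal{A}_{n,p}=\bigoplus_{\mathbb{Z}}(\mathbb{Z}/p\mathbb{Z})^n$ is identified with $R^n$, $x$ acting by the shift $(x\omega)_i=\omega_{i+1}$. $\mathcal{L}_{n,p}=\mathcal{A}_{n,p}\rtimes\mathbb{Z}$ with elements $(w,t)$ and product $(v,s)(w,t)=(v+x^sw,s+t)$. For an additive subgroup $U$, $e(U)$ is the minimal positive $e$ with $x^eU=U$ ($+\infty$ if none). Given $s>0$, an additive subgroup $U\subset\mathcal{A}_{n,p}$ with $x^sU=U$, and $v\in\mathcal{A}_{n,p}$, the subgroup with triple $(s,U,v)$ is the unique subgroup $V\le\mathcal{L}_{n,p}$ whose projection to $\mathbb{Z}$ is $s\mathbb{Z}$, with $V\cap\mathcal{A}_{n,p}=U$ and $(v,s)\in V$; explicitly $V=\{(w,t): s\mid t,\ (w,t)(v,s)^{-t/s}\in U\times\{0\}\}$. Convergence in ${\rm Sub}(\mathcal{L}_{n,p})$ and of subsets of $R^n$ is pointwise convergence of indicator functions. *)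

(* Defs.v *)
From mathcomp Require Import all_boot all_algebra.
Set Implicit Arguments. Unset Strict Implicit. Unset Printing Implicit Defensive.
Import GRing.Theory Num.Theory.
Local Open Scope ring_scope.

(* World: plain MathComp.
   A_{n,p} = (+)_{Z} (Z/pZ)^n : finitely supported maps  Z -> 'I_n -> 'F_p. *)
Definition seqA (n p : nat) := int -> 'I_n -> 'F_p.

Definition finsupp n p (w : seqA n p) : Prop :=
  exists N : nat, forall i : int, (N < absz i)%N -> forall j, w i j = 0.

Definition zeroA n p : seqA n p := fun _ _ => 0.
Definition addA n p (w1 w2 : seqA n p) : seqA n p := fun i j => w1 i j + w2 i j.
Definition oppA n p (w : seqA n p) : seqA n p := fun i j => - w i j.

(* x^k acting by the shift: (x^k w)_i = w_{i+k} *)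
Definition shiftn n p (k : int) (w : seqA n p) : seqA n p := fun i => w (i + k).

Definition add_subgroup n p (U : seqA n p -> Prop) : Prop :=
  (forall w, U w -> finsupp w) /\ U (@zeroA n p) /\
  (forall w1 w2, U w1 -> U w2 -> U (addA w1 w2)) /\
  (forall w, U w -> U (oppA w)).

Definition is_period n p (U : seqA n p -> Prop) (e : nat) : Prop :=
  forall w, (exists u, U u /\ w = shiftn (e%:Z) u) <-> U w.

Definition e_divides n p (U : seqA n p -> Prop) (s : nat) : Prop :=
  exists e : nat, [/\ (0 < e)%N, is_period U e,
    (forall e' : nat, (0 < e')%N -> is_period U e' -> (e <= e')%N) & (e %| s)%N].

(* L_{n,p} = A_{n,p} x| Z *)
Definition elL n p := (seqA n p * int)%type.
Definition mulL n p (a b : elL n p) : elL n p :=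
  (addA a.1 (shiftn a.2 b.1), a.2 + b.2).
Definition oneL n p : elL n p := (@zeroA n p, 0).
Definition invL n p (a : elL n p) : elL n p :=
  (oppA (shiftn (- a.2) a.1), - a.2).
Definition powL n p (g : elL n p) (k : int) : elL n p :=
  match k with
  | Posz m => iter m (mulL g) (@oneL n p)
  | Negz m => invL (iter m.+1 (mulL g) (@oneL n p))
  end.

Definition triple_subgroup n p (s : nat) (U : seqA n p -> Prop) (v : seqA n p)
  (g : elL n p) : Prop :=
  (s%:Z %| g.2)%Z /\
  (let h := mulL g (powL (v, s%:Z) (- (g.2 %/ s%:Z)%Z)) in U h.1 /\ h.2 = 0).

(* convergence of subsets of A (pointwise convergence of indicators) *)
Definition conv_subsetsA n p (Um : nat -> seqA n p -> Prop) (U : seqA n p -> Prop) : Prop :=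
  forall w, finsupp w -> exists M : nat, forall m, (M <= m)%N -> (Um m w <-> U w).

Definition conv_subL n p (Vm : nat -> elL n p -> Prop) (V : elL n p -> Prop) : Prop :=
  forall g : elL n p, finsupp g.1 ->
    exists M : nat, forall m, (M <= m)%N -> (Vm m g <-> V g).

(* Main.v *)
Require Import Defs.
From mathcomp Require Import all_boot all_algebra.
From Stdlib Require Import Classical.

(* Whether [g] lies in the subgroup with triple [(s, U, v)] depends on [U] only
   through the membership in [U] of one element of [A_{n,p}], namely the
   [A]-component of [g (v, s)^(-t/s)].  Convergence [U_m --> U] at that single
   point therefore gives convergence [V_m --> V] at [g]. *)

(* [conv_subsetsA] only tests finitely supported points; the others lie in
   no additive subgroup, so convergence holds there trivially. *)
Lemma conv_subsetsA_at {n p : nat} {Um : nat -> seqA n p -> Prop} {U : seqA n p -> Prop} :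
  (forall m, add_subgroup (Um m)) -> add_subgroup U -> conv_subsetsA Um U ->
  forall w, exists M : nat, forall m, (M <= m)%N -> (Um m w <-> U w).
Proof.
move=> subUm subU convU w.
have [fw | nfw] := classic (finsupp w); first exact: convU.
exists 0%N => m _.
by split=> [/(proj1 (subUm m)) | /(proj1 subU)].
Qed.

Theorem lemma6p17 (p n s : nat) (U : seqA n p -> Prop) (Um : nat -> seqA n p -> Prop)
  (v : seqA n p) :
  prime p -> (1 <= n)%N -> (0 < s)%N ->
  add_subgroup U -> (forall m, add_subgroup (Um m)) ->
  (forall m w, U w -> Um m w) ->
  e_divides U s -> (forall m, e_divides (Um m) s) ->
  conv_subsetsA Um U ->
  finsupp v ->
  conv_subL (fun m => triple_subgroup s (Um m) v) (triple_subgroup s U v).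
Proof.
move=> _ _ _ subU subUm _ _ _ convU _ g _.
rewrite /triple_subgroup; set h := mulL g _.
have [M HM] := conv_subsetsA_at subUm subU convU h.1.
by exists M => m /HM; tauto.
Qed.
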